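(* Let $q$ be a prime power and let $n_1\ge k_1\ge 1$, $n_2\ge k_2\ge 1$ and $t$ be integers with $0\le t\le\min\{k_1,k_2\}$, $t<k_1+k_2-t$, and $n_1-k_1\le n_2-k_2$. Suppose that $n_2-k_2+1\ge t$ and that there exist, over $\mathbb{F}_q$, a pair of nested $(k_1-t,k_1;n_1)$ MDS codes and a pair of nested $(k_2-t,k_2;n_2)$ MDS codes. Then there exists an optimal $[n_1,k_1;n_2,k_2;t]$-LEDC over $\mathbb{F}_q$ whose minimum distance is $n_1-k_1+t+1$.
   Context: For $1\le k'<k\le n$, a pair of nested $(k',k;n)$ MDS codes over $\mathbb{F}_q$ is a pair $(\mathcal{C}',\mathcal{C})$ of linear codes with $\mathcal{C}'\subset\mathcal{C}\subseteq\mathbb{F}_q^n$ such that $\mathcal{C}'$ and $\mathcal{C}$ are $[n,k']$ and $[n,k]$ MDS codes, respectively. (An $[n,k]$ linear code is MDS if its minimum Hamming distance is $n-k+1$.) Put $k=k_1+k_2-t$, $n=n_1+n_2$, $K_1=\{1,\dots,k_1\}$, $K_2=\{k_1-t+1,\dots,k\}$, $N_1=\{1,\dots,n_1\}$, $N_2=\{n_1+1,\dots,n\}$, so that $|K_1\cap K_2|=t$. An $[n_1,k_1;n_2,k_2;t]$-LEDC over $\mathbb{F}_q$ is a linear map $x\mapsto c=xG$, $\mathbb{F}_q^k\to\mathbb{F}_q^n$, given by a $k\times n$ matrix $G$ over $\mathbb{F}_q$, such that for $i=1,2$: (P1) the coded symbols $\{c_j : j\in N_i\}$ depend only on the data symbols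 $\{x_j : j\in K_i\}$; (P2) the data symbols $\{x_j : j\in K_i\}$ are determined by any $k_i$ of the coded symbols $\{c_j : j\in N_i\}$. Its minimum distance is the minimum Hamming distance of the linear code $\{xG : x\in\mathbb{F}_q^k\}$. It is called optimal if its minimum distance is the largest possible among all $[n_1,k_1;n_2,k_2;t]$-LEDCs with the same parameters (over any finite field). *)

(* Defs.v *)
From HB Require Import structures.
From mathcomp Require Import all_boot all_order all_algebra.
Set Implicit Arguments.
Unset Strict Implicit.
Unset Printing Implicit Defensive.

Import GRing.Theory.
Local Open Scope nat_scope.

Definition hamming (F : finFieldType) (n : nat) (u v : 'rV[F]_n) : nat :=
  #|[set j : 'I_n | u 0%R j != v 0%R j]|.

(* A relation rather than a function: the zero code has no minimum distance. *)
Definition min_distance (F : finFieldType) (n : nat)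
    (C : {vspace 'rV[F]_n}) (d : nat) : Prop :=
  (exists u v, [/\ u \in C, v \in C, u != v & hamming u v = d]) /\
  (forall u v, u \in C -> v \in C -> u != v -> d <= hamming u v).

Definition MDS (F : finFieldType) (n k : nat) (C : {vspace 'rV[F]_n}) : Prop :=
  \dim C = k /\ min_distance C (n - k + 1).

(* The inclusion is automatically strict, since the dimensions differ. *)
Definition nested_MDS (F : finFieldType) (k' k n : nat)
    (C' C : {vspace 'rV[F]_n}) : Prop :=
  1 <= k' /\ k' < k <= n /\ (C' <= C)%VS /\ MDS k' C' /\ MDS k C.

Definition generated_code (F : finFieldType) (k n : nat) (G : 'M[F]_(k, n)) :
    {vspace 'rV[F]_n} :=
  limg (linfun (mulmxr G : 'rV[F]_k -> 'rV[F]_n)).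


(* Indices start at 0, so {1,...,k1} becomes {0,...,k1-1} and so on. *)
Definition K1 (k1 k2 t : nat) : {set 'I_(k1 + k2 - t)} :=
  [set j : 'I_(k1 + k2 - t) | j < k1].
Definition K2 (k1 k2 t : nat) : {set 'I_(k1 + k2 - t)} :=
  [set j : 'I_(k1 + k2 - t) | k1 - t <= j].
Definition N1 (n1 n2 : nat) : {set 'I_(n1 + n2)} :=
  [set j : 'I_(n1 + n2) | j < n1].
Definition N2 (n1 n2 : nat) : {set 'I_(n1 + n2)} :=
  [set j : 'I_(n1 + n2) | n1 <= j].

Definition agree_on (F : finFieldType) (m : nat) (A : {set 'I_m})
    (x y : 'rV[F]_m) : Prop :=
  forall j, j \in A -> x 0%R j = y 0%R j.

Definition depends_only_on (F : finFieldType) (k n : nat) (G : 'M[F]_(k, n))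
    (N : {set 'I_n}) (K : {set 'I_k}) : Prop :=
  forall x y : 'rV[F]_k, agree_on K x y -> agree_on N (x *m G)%R (y *m G)%R.

Definition determined_by_any (F : finFieldType) (k n : nat) (G : 'M[F]_(k, n))
    (K : {set 'I_k}) (N : {set 'I_n}) (m : nat) : Prop :=
  forall S : {set 'I_n}, S \subset N -> #|S| = m ->
  forall x y : 'rV[F]_k, agree_on S (x *m G)%R (y *m G)%R -> agree_on K x y.

Definition LEDC (F : finFieldType) (n1 k1 n2 k2 t : nat)
    (G : 'M[F]_(k1 + k2 - t, n1 + n2)) : Prop :=
  [/\ depends_only_on G (N1 n1 n2) (K1 k1 k2 t),
      depends_only_on G (N2 n1 n2) (K2 k1 k2 t),
      determined_by_any G (K1 k1 k2 t) (N1 n1 n2) k1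
    & determined_by_any G (K2 k1 k2 t) (N2 n1 n2) k2].

Arguments LEDC {F} n1 k1 n2 k2 t G.

Definition optimal_LEDC (F : finFieldType) (n1 k1 n2 k2 t : nat)
    (G : 'M[F]_(k1 + k2 - t, n1 + n2)) : Prop :=
  LEDC n1 k1 n2 k2 t G /\
  exists2 d, min_distance (generated_code G) d &
    forall (F' : finFieldType) (G' : 'M[F']_(k1 + k2 - t, n1 + n2)) (d' : nat),
      LEDC n1 k1 n2 k2 t G' -> min_distance (generated_code G') d' -> d' <= d.
Arguments optimal_LEDC {F} n1 k1 n2 k2 t G.

(* Main.v *)
Require Import Defs.
From HB Require Import structures.
From mathcomp Require Import all_boot all_order all_algebra.
From mathcomp Require Import zify.
Set Implicit Arguments.
Unset Strict Implicit.
Unset Printing Implicit Defensive.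

Import GRing.Theory.
Local Open Scope nat_scope.

(* The data is split as (xa, xs, xb), where xs are the t shared symbols.  In the
   code G = [A1 0; B1 B2; 0 A2], the rows of Ai span the small code and those of
   Ai and Bi the large code of the i-th nested pair.  If xs = 0, then the
   distance of a small code applies; otherwise both blocks are nonzero in the
   large codes, and (n1 - k1 + 1) + (n2 - k2 + 1) >= n1 - k1 + 1 + t.
   For optimality, put xs = xb = 0 in an arbitrary LEDC: the second block
   vanishes, and xa can be chosen nonzero with k1 - t - 1 coordinates of the
   first block equal to zero. *)

Lemma hammingxx (F : finFieldType) n (u : 'rV[F]_n) : hamming u u = 0.
Proof. by rewrite /hamming eq_card0 // => j; rewrite !inE eqxx. Qed.

Lemma hammingB (F : finFieldType) n (u v : 'rV[F]_n) :
  hamming u v = hamming (u - v)%R 0%R.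
Proof. by apply: eq_card => j; rewrite !inE !mxE subr_eq0. Qed.

Lemma hamming_split (F : finFieldType) n1 n2 (u v : 'rV[F]_(n1 + n2)) :
  hamming u v =
  hamming (lsubmx u) (lsubmx v) + hamming (rsubmx u) (rsubmx v).
Proof.
rewrite /hamming -!sum1_card !(big_mkcond (fun j => j \in _)) big_split_ord /=.
by congr (_ + _); apply: eq_bigr => j _; rewrite !inE !mxE.
Qed.

(** Inside the block selected by [f], the positions of disagreement are disjoint from [S], and the
    block has only [m] positions. This turns agreement on a set of coded symbols into a bound on the
    distance. *)
Lemma agree_on_hamming (F : finFieldType) m n (f : 'I_m -> 'I_n)
    (S : {set 'I_n}) (u v : 'rV[F]_n) :
  injective f -> S \subset f @: setT -> agree_on S u v ->
  hamming (colsub f u) (colsub f v) + #|S| <= m.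
Proof.
move=> fI Sf uvS; set D := [set j | colsub f u 0%R j != colsub f v 0%R j].
have mE : #|f @: setT| = m by rewrite card_imset // cardsT card_ord.
rewrite -[X in _ <= X]mE /hamming -/D -(card_imset _ fI) -cardsUI.
have -> : f @: D :&: S = set0.
  apply/setP=> j; rewrite !inE; apply/negP=> /andP[/imsetP[i iD ->] iS].
  by move: iD; rewrite inE !mxE uvS ?eqxx.
by rewrite cards0 addn0 subset_leq_card // subUset Sf imsetS ?subsetT.
Qed.

Lemma N1_lshift n1 n2 : N1 n1 n2 = lshift n2 @: setT.
Proof.
apply/setP=> j; rewrite inE; apply/idP/imsetP => [jn|[i _ ->]]; last exact: ltn_ord i.
by exists (Ordinal jn) => //; apply: val_inj.
Qed.

Lemma N2_rshift n1 n2 : N2 n1 n2 = @rshift n1 n2 @: setT.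
Proof.
apply/setP=> j; rewrite inE; apply/idP/imsetP => [jn|[i _ ->]]; last exact: leq_addr.
have jn2 : j - n1 < n2 by have := ltn_ord j; lia.
by exists (Ordinal jn2) => //; apply: val_inj => /=; rewrite subnKC.
Qed.

Lemma generated_codeP (F : finFieldType) k n (G : 'M[F]_(k, n)) u :
  reflect (exists x, u = (x *m G)%R) (u \in generated_code G).
Proof.
apply: (iffP memv_imgP) => [[x _ ->]|[x ->]]; exists x => //.
- by rewrite lfunE.
- exact: memvf.
- by rewrite lfunE.
Qed.

(** By linearity distances are weights. The lower bound runs over nonzero data, which covers all
    nonzero codewords since [0] encodes to [0]. *)
Lemma generated_min_distance (F : finFieldType) k n (G : 'M[F]_(k, n)) d :
  (forall x, x != 0%R -> d <= hamming (x *m G)%R 0%R) ->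
  (exists2 x, (x *m G)%R != 0%R & hamming (x *m G)%R 0%R <= d) ->
  min_distance (generated_code G) d.
Proof.
move=> lowG [x xG xd]; split.
  exists (x *m G)%R, 0%R; split=> //.
  - by apply/generated_codeP; exists x.
  - exact: mem0v.
  apply/eqP; rewrite eqn_leq xd lowG //.
  by apply: contraNneq xG => ->; rewrite mul0mx.
move=> _ _ /generated_codeP[y ->] /generated_codeP[z ->] yz.
rewrite hammingB -mulmxBl lowG //.
by apply: contraNneq yz => /eqP; rewrite subr_eq0 => /eqP ->.
Qed.

Lemma min_distance_mul_basis (F : finFieldType) n k (C : {vspace 'rV[F]_n}) d
    (X : seq 'rV[F]_n) (v : 'rV[F]_k) :
  min_distance C d -> basis_of C X -> size X = k -> v != 0%R ->
  d <= hamming (v *m \matrix_(i < k) X`_i)%R 0%R.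
Proof.
move=> [_ lowC] XC sX v0.
(* [freeP] speaks of tuples: generalizing [in_tuple X] lets [sX] turn its length into [k], while
   [eX] keeps the link to [X]. *)
have eX : X = in_tuple X by [].
move: (in_tuple X) eX; rewrite sX => T eX; rewrite eX in XC *.
have vE : (v *m \matrix_(i < k) T`_i = \sum_i v 0 i *: T`_i)%R.
  by rewrite mulmx_sum_row; apply: eq_bigr => i _; rewrite rowK.
apply: lowC; rewrite ?mem0v // vE.
  rewrite memv_suml // => i _; apply/memvZ/(basis_mem XC)/mem_nth.
  by rewrite size_tuple.
apply: contra v0 => /eqP vT; apply/eqP/rowP => i; rewrite mxE.
by move/freeP: (basis_free XC) => /(_ (fun i => v 0%R i) vT).
Qed.

(** A basis of [C'], completed by one of the complement [C :\: C'], is a basis of [C]; taken as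
    rows, its top [k'] vectors span [C']. *)
Lemma nested_MDS_matrix (F : finFieldType) k' t n (C' C : {vspace 'rV[F]_n}) :
  nested_MDS k' (k' + t) C' C ->
  exists M : 'M[F]_(k' + t, n),
    (forall v, v != 0%R -> n - k' + 1 <= hamming (v *m usubmx M)%R 0%R) /\
    (forall v, v != 0%R -> n - (k' + t) + 1 <= hamming (v *m M)%R 0%R).
Proof.
move=> [_ [_ [CC [[dC' mC'] [dC mC]]]]].
pose X := vbasis C' ++ vbasis (C :\: C').
have eC : (C' + (C :\: C') = C)%VS by rewrite addvC -{2}(addv_diff_cap C C') (capv_idPr CC).
have XC : basis_of C X.
  rewrite -{1}eC; apply: cat_basis; rewrite ?vbasisP //.
  by apply/directv_addP; rewrite capvC capv_diff.
have sX : size X = k' + t by rewrite -dC -(size_basis (X := in_tuple X) XC).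
exists (\matrix_(i < k' + t) X`_i)%R; split=> v v0; last first.
  exact: (min_distance_mul_basis mC XC).
have -> : (usubmx (\matrix_(i < k' + t) X`_i) = \matrix_(i < k') (vbasis C')`_i)%R.
  apply/matrixP=> i j; rewrite !mxE /= nth_cat size_tuple.
  by rewrite [X in _ < X]dC' ltn_ord.
by apply: (min_distance_mul_basis mC' (vbasisP C')); rewrite ?size_tuple.
Qed.

Lemma nonzero_kernel (F : fieldType) m n (A : 'M[F]_(m, n)) :
  n < m -> exists2 v : 'rV_m, v != 0%R & (v *m A = 0)%R.
Proof.
move=> nm; have : kermx A != 0%R.
  by rewrite kermx_eq0 /row_free neq_ltn (leq_ltn_trans (rank_leq_col A)).
by move=> /rowV0Pn[v /sub_kermxP vA v0]; exists v.
Qed.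

(** Here [a] is $k_1-t$ and [b] is $k_2-t$. Being valid for every LEDC, the bound both shows that
    the constructed code attains its distance and limits all competitors. *)
Lemma light_codeword (F : finFieldType) a t b n1 n2
    (G : 'M[F]_(a + (t + b), n1 + n2)) :
  0 < a -> a + t <= n1 ->
  depends_only_on G (N2 n1 n2) [set j : 'I_(a + (t + b)) | a <= j] ->
  determined_by_any G [set j : 'I_(a + (t + b)) | j < a + t]
    (N1 n1 n2) (a + t) ->
  exists2 x, (x *m G)%R != 0%R & hamming (x *m G)%R 0%R <= n1 - a + 1.
Proof.
move=> a0 an dep det.
(* Only [a.-1] zeros are imposed, so that [a] unknowns leave a nonzero solution. *)
have apn : a.-1 <= n1 by lia.
pose g (j : 'I_a.-1) := lshift n2 (widen_ord apn j).
have gI : injective g by move=> i j /(congr1 val) /= ij; apply: val_inj.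
have [|v v0 vG] := @nonzero_kernel F _ _ (colsub g (usubmx G)); first by lia.
pose x : 'rV[F]_(a + (t + b)) := row_mx v 0%R.
have xGg : forall j, (x *m G)%R 0%R (g j) = 0%R.
  move=> j; move/matrixP/(_ 0%R j): vG; rewrite -{2}(vsubmxK G) mul_row_col.
  by rewrite mul0mx addr0 mulmx_colsub !mxE.
exists x.
  (* If [x] encoded to [0], it would agree with the zero data on [a + t] symbols of the first block,
     so [det] would make [v] vanish. *)
  apply: contraNneq v0 => xG.
  pose h (j : 'I_(a + t)) := lshift n2 (widen_ord an j).
  have hI : injective h by move=> i j /(congr1 val) /= ij; apply: val_inj.
  have hN : h @: setT \subset N1 n1 n2.
    by apply/subsetP=> _ /imsetP[j _ ->]; rewrite inE /= (leq_trans (ltn_ord j)).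
  have := det _ hN _ x 0%R; rewrite card_imset // cardsT card_ord => /(_ erefl).
  rewrite xG mul0mx => /(_ (fun _ _ => erefl)) x0.
  apply/eqP/rowP => i; have := x0 (lshift _ i).
  by rewrite inE /= row_mxEl !mxE; apply; rewrite ltn_addr.
rewrite hamming_split.
have -> : rsubmx (x *m G)%R = rsubmx (0%R : 'rV_(n1 + n2)).
  apply/rowP=> j; rewrite !mxE.
  have := dep x 0%R _ (rshift n1 j); rewrite mul0mx !mxE; apply.
    move=> i; rewrite inE => ai; rewrite -(splitK i) /=.
    case: splitP => [i' ii'|i' _]; first by move: ai; rewrite ii' leqNgt ltn_ord.
    by rewrite /= row_mxEr !mxE.
  by rewrite inE leq_addr.
rewrite hammingxx addn0.
have -> : n1 - a + 1 = n1 - a.-1 by lia.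
rewrite leq_subRL // addnC.
have := @agree_on_hamming F _ _ (lshift n2) (g @: setT) (x *m G)%R 0%R.
rewrite card_imset // cardsT card_ord !lsubmxEsub.
apply; first exact: lshift_inj.
  by apply/subsetP=> _ /imsetP[j _ ->]; apply: imset_f.
by move=> _ /imsetP[j _ ->]; rewrite xGg mxE.
Qed.

(** Writing the dimension as [a + (t + b)] puts the three data segments into the type, so block
    matrices apply without casts. *)
Lemma nested_code_LEDC (F : finFieldType) a t b n1 n2
    (M1 : 'M[F]_(a + t, n1)) (M2 : 'M[F]_(b + t, n2)) :
  a + t <= n1 -> b + t <= n2 -> n1 - (a + t) <= n2 - (b + t) ->
  t <= n2 - (b + t) + 1 ->
  (forall v, v != 0%R -> n1 - a + 1 <= hamming (v *m usubmx M1)%R 0%R) ->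
  (forall v, v != 0%R -> n1 - (a + t) + 1 <= hamming (v *m M1)%R 0%R) ->
  (forall v, v != 0%R -> n2 - b + 1 <= hamming (v *m usubmx M2)%R 0%R) ->
  (forall v, v != 0%R -> n2 - (b + t) + 1 <= hamming (v *m M2)%R 0%R) ->
  exists G : 'M[F]_(a + (t + b), n1 + n2),
    let K1 := [set j : 'I_(a + (t + b)) | j < a + t] in
    let K2 := [set j : 'I_(a + (t + b)) | a <= j] in
    [/\ depends_only_on G (N1 n1 n2) K1, depends_only_on G (N2 n1 n2) K2,
        determined_by_any G K1 (N1 n1 n2) (a + t),
        determined_by_any G K2 (N2 n1 n2) (b + t)
      & forall x, x != 0%R -> n1 - a + 1 <= hamming (x *m G)%R 0%R].
Proof.
move=> an bn hr hrt a1 m1 a2 m2.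
pose G := col_mx (row_mx (usubmx M1) 0%R)
  (col_mx (row_mx (dsubmx M1) (dsubmx M2)) (row_mx 0%R (usubmx M2))).
pose x1 (x : 'rV[F]_(a + (t + b))) := row_mx (lsubmx x) (lsubmx (rsubmx x)).
(* The segments are swapped: [M2] has its [b] small-code rows first, whereas in [x] the shared
   symbols come first. *)
pose x2 (x : 'rV[F]_(a + (t + b))) :=
  row_mx (rsubmx (rsubmx x)) (lsubmx (rsubmx x)).
have GE x : (x *m G = row_mx (x1 x *m M1) (x2 x *m M2))%R.
  rewrite -[in LHS](hsubmxK x) -[in LHS](hsubmxK (rsubmx x)) !mul_row_col.
  rewrite !mul_mx_row !mulmx0 !add_row_mx add0r addr0 /x1 /x2.
  by rewrite -[in RHS](vsubmxK M1) -[in RHS](vsubmxK M2) !mul_row_col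
    [X in row_mx _ X]addrC.
have x1P x y : agree_on [set j : 'I__ | j < a + t] x y <-> x1 x = x1 y.
  split=> [xy|/rowP xy j].
    apply/rowP=> j; rewrite !mxE; case: splitP => i ji; rewrite !mxE.
      by apply: xy; rewrite inE /= ltn_addr.
    by apply: xy; rewrite inE /= ltn_add2l.
  rewrite inE => ja; have := xy (Ordinal ja); rewrite !mxE.
  case: splitP => i /= ji; rewrite !mxE.
    by have -> : j = lshift _ i by apply: val_inj.
  by have -> : j = rshift _ (lshift _ i) by apply: val_inj.
have x2P x y : agree_on [set j : 'I__ | a <= j] x y <-> x2 x = x2 y.
  split=> [xy|xy j].
    apply/rowP=> j; rewrite !mxE; case: splitP => i ji; rewrite !mxE.
      by apply: xy; rewrite inE /= leq_addr.
    by apply: xy; rewrite inE /= leq_addr.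
  have [/rowP xyb /rowP xys] := eq_row_mx xy.
  rewrite inE -(splitK j) /=; case: splitP => i /= ji.
    by rewrite leqNgt ltn_ord.
  move=> _; rewrite -(splitK i) /=; case: splitP => l _ /=.
    by have := xys l; rewrite !mxE.
  by have := xyb l; rewrite !mxE.
(* Codewords that agree in [m] places are at distance at most [n - m], below the MDS distance
   [n - m + 1], hence equal. *)
have det m n (M : 'M[F]_(m, n)) (u v : 'rV[F]_m) :
    (forall v, v != 0%R -> n - m + 1 <= hamming (v *m M)%R 0%R) -> m <= n ->
    hamming (u *m M)%R (v *m M)%R + m <= n -> u = v.
  move=> low mn; rewrite hammingB -mulmxBl addnC -leq_subRL // => uv.
  apply/eqP; rewrite -subr_eq0; apply/negPn/negP => /low /leq_trans /(_ uv).
  by rewrite addn1 ltnn.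
exists G; split.
- move=> x y /x1P xy; rewrite N1_lshift => _ /imsetP[j _ ->].
  by rewrite !GE !row_mxEl xy.
- move=> x y /x2P xy; rewrite N2_rshift => _ /imsetP[j _ ->].
  by rewrite !GE !row_mxEr xy.
- move=> S; rewrite N1_lshift => SN cS x y xyS.
  have := agree_on_hamming (@lshift_inj _ _) SN xyS.
  rewrite -!lsubmxEsub !GE !row_mxKl cS => xy.
  by apply/x1P/(det _ _ M1).
- move=> S; rewrite N2_rshift => SN cS x y xyS.
  have := agree_on_hamming (@rshift_inj _ _) SN xyS.
  rewrite -!rsubmxEsub !GE !row_mxKr cS => xy.
  by apply/x2P/(det _ _ M2).
move=> x x0; rewrite GE hamming_split !row_mxKl !row_mxKr !linear0.
have [xs0|xs0] := eqVneq (lsubmx (rsubmx x)) 0%R; last first.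
  (* The second block contributes at least [t] by the hypothesis [t <= n2 - (b + t) + 1]. *)
  apply: leq_trans (leq_add (m1 (x1 x) _) (m2 (x2 x) _)); first by lia.
    by rewrite row_mx_eq0 negb_and xs0 orbT.
  by rewrite row_mx_eq0 negb_and xs0 orbT.
(* Without shared symbols both blocks lie in the small codes. If [xa] is zero too, the second block
   alone suffices, as [n1 - a <= n2 - b]. *)
rewrite /x1 /x2 xs0 -{1}(vsubmxK M1) -(vsubmxK M2) !mul_row_col !mul0mx !addr0.
have [xa0|/a1 xa] := eqVneq (lsubmx x) 0%R; last exact: leq_trans (leq_addr _ _).
apply: leq_trans (leq_addl _ _); apply: leq_trans (a2 _ _); first by lia.
apply: contraNneq x0 => xb0.
by rewrite -(hsubmxK x) -(hsubmxK (rsubmx x)) xa0 xs0 xb0 !row_mx0.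
Qed.

Theorem theorem3 (F : finFieldType) (n1 k1 n2 k2 t : nat)
  (hk1 : 1 <= k1) (hn1 : k1 <= n1) (hk2 : 1 <= k2) (hn2 : k2 <= n2)
  (ht : t <= minn k1 k2) (htk : t < k1 + k2 - t)
  (hr : n1 - k1 <= n2 - k2) (hrt : t <= n2 - k2 + 1)
  (h1 : exists C' C : {vspace 'rV[F]_n1}, nested_MDS (k1 - t) k1 C' C)
  (h2 : exists C' C : {vspace 'rV[F]_n2}, nested_MDS (k2 - t) k2 C' C) :
  exists G : 'M[F]_(k1 + k2 - t, n1 + n2),
    optimal_LEDC n1 k1 n2 k2 t G /\ min_distance (generated_code G) (n1 - k1 + t + 1).
Proof.
have [tk1 tk2] : t <= k1 /\ t <= k2 by lia.
case: h1 => C1' [C1 nest1]; case: h2 => C2' [C2 nest2].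
have a0 : 0 < k1 - t by case: nest1.
(* Unfolding exposes every occurrence of [k1 + k2 - t] in the types, so that it can be replaced by
   [a + (t + b)] once [k1 - t] and [k2 - t] are generalized. *)
rewrite /optimal_LEDC /LEDC /K1 /K2.
have eD : n1 - k1 + t + 1 = n1 - (k1 - t) + 1 by lia.
have eK : k1 + k2 - t = (k1 - t) + (t + (k2 - t)) by lia.
rewrite eD eK.
have e1 : k1 = k1 - t + t by lia.
have e2 : k2 = k2 - t + t by lia.
move: (k1 - t) (k2 - t) e1 e2 a0 nest1 nest2 {eD eK tk1 tk2 ht htk hk1 hk2} => a b.
move=> e1 e2; subst k1 k2 => a0.
move=> /nested_MDS_matrix[M1 [s1 m1]] /nested_MDS_matrix[M2 [s2 m2]].
have [G [dep1 dep2 det1 det2 low]] := nested_code_LEDC hn1 hn2 hr hrt s1 m1 s2 m2.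
have minG : min_distance (generated_code G) (n1 - a + 1).
  exact/(generated_min_distance low)/(light_codeword a0 hn1).
exists G; split=> //; split=> //; exists (n1 - a + 1) => //.
(* The light codeword exists over any field [F'], which bounds [d']. *)
move=> F' G' d' [_ dep' det' _] [_ lowG'].
have [x xG0 xd] := light_codeword a0 hn1 dep' det'.
apply: leq_trans xd; apply: lowG' => //; last exact: mem0v.
by apply/generated_codeP; exists x.
Qed.
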